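(* Let $R$ be a commutative Noetherian ring, let $n\ge 0$ be an integer, and let $M$ be a finitely generated $R$-module such that for all prime ideals $\mathfrak p,\mathfrak q\in\mathfrak C_n$, $\operatorname{depth}(R_{\mathfrak p})>\operatorname{depth}(R_{\mathfrak q})$ implies $\mu(M_{\mathfrak p})\ge \mu(M_{\mathfrak q})$. Then: (1) If $\mu(M_{\mathfrak p})>n$ for every $\mathfrak p\in\mathfrak C_n$, then there exists $x\in M$ which is basic in $M$ at every $\mathfrak p\in\mathfrak C_n$. (2) Let $k\ge 1$, let $x_1,\dots,x_k\in M$ and put $M'=\sum_{i=1}^k Rx_i$. If, for every $\mathfrak p\in\mathfrak C_n$, $M'$ is $\min(k,\,n+1-\operatorname{depth}(R_{\mathfrak p}))$-basic in $M$ at $\mathfrak p$, then there exists $x'\in\sum_{i=2}^k Rx_i$ such that $x_1+x'$ is basic in $M$ at every $\mathfrak p\in\mathfrak C_n$.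
   Context: All modules are finitely generated. For a finitely generated module $N$ over a local ring, $\mu(N)$ denotes the minimal number of generators of $N$. For an integer $n\ge 0$, $\mathfrak C_n$ denotes the set of prime ideals $\mathfrak p$ of $R$ with $\operatorname{depth}(R_{\mathfrak p})\le n$. For a submodule $M'\subseteq M$, an integer $s$ and a prime $\mathfrak p$, $M'$ is called $s$-basic in $M$ at $\mathfrak p$ if $\mu((M/M')_{\mathfrak p})\le \mu(M_{\mathfrak p})-s$. An element $x\in M$ is called basic in $M$ at $\mathfrak p$ if $Rx$ is $1$-basic in $M$ at $\mathfrak p$. *)

(* Defs.v *)
(* Elementary (R-level) unfolding of localization notions. *)
From HB Require Import structures.
From mathcomp Require Import all_boot all_order all_algebra.
From Stdlib Require Import ClassicalEpsilon.
Set Implicit Arguments. Unset Strict Implicit. Unset Printing Implicit Defensive.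
Import Order.TTheory GRing.Theory Num.Theory.
Local Open Scope ring_scope.

(* least upper bound of a set of naturals (meaningful when bounded) *)
Definition natsup (P : nat -> Prop) : nat :=
  epsilon (inhabits 0%N) (fun m => (forall k, P k -> (k <= m)%N) /\
     forall m', (forall k, P k -> (k <= m')%N) -> (m <= m')%N).

(* least element of a set of naturals (meaningful when nonempty) *)
Definition natmin (P : nat -> Prop) : nat :=
  epsilon (inhabits 0%N) (fun m => P m /\ forall k, P k -> (m <= k)%N).

Section Defs.
Variable R : comNzRingType.

Definition ispan (s : seq R) (r : R) : Prop :=
  exists c : seq R, r = \sum_(i < size s) c`_i * s`_i.

Definition is_ideal (I : R -> Prop) : Prop :=
  [/\ I 0, (forall a b, I a -> I b -> I (a + b)) & (forall r a, I a -> I (r * a))].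

Definition prime_ideal (p : R -> Prop) : Prop :=
  [/\ is_ideal p, ~ p 1 & (forall a b, p (a * b) -> p a \/ p b)].

Definition noetherian : Prop :=
  forall I : R -> Prop, is_ideal I -> exists s : seq R, forall r, I r <-> ispan s r.

(* a_1,...,a_k (elements of p) form an R_p-regular sequence:
   a_i/1 is a nonzerodivisor on R_p/(a_1,...,a_{i-1})R_p; note that
   r/s lies in (a_1..a_{i-1})R_p iff t*r lies in (a_1..a_{i-1}) for some t notin p *)
Definition loc_regular_seq (p : R -> Prop) (a : seq R) : Prop :=
  (forall i, (i < size a)%N -> p a`_i) /\
  forall i, (i < size a)%N -> forall r : R,
    (exists t, ~ p t /\ ispan (take i a) (t * (a`_i * r))) ->
    exists t, ~ p t /\ ispan (take i a) (t * r).

Definition depth (p : R -> Prop) : nat :=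
  natsup (fun k => exists a : seq R, size a = k /\ loc_regular_seq p a).

Definition Cn (n : nat) (p : R -> Prop) : Prop := prime_ideal p /\ (depth p <= n)%N.

Variable M : lmodType R.

Definition mspan (s : seq M) (x : M) : Prop :=
  exists c : seq R, x = \sum_(i < size s) c`_i *: s`_i.

Definition fin_gen : Prop := exists s : seq M, forall x, mspan s x.

(* mu((M/N)_p) for a submodule N of M: least number of elements of (M/N)_p
   generating it over R_p.  Generators may be taken of the form g/1 (denominators
   are units), and y/s lies in their R_p-span iff u*y lies in span(g) + N for some u notin p. *)
Definition mu_quot (p : R -> Prop) (N : M -> Prop) : nat :=
  natmin (fun m => exists g : seq M, size g = m /\
     forall y : M, exists u : R, ~ p u /\ exists z : M, N z /\ mspan g (u *: y - z)).

Definition mu (p : R -> Prop) : nat := mu_quot p (fun z => z = 0).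

Definition sbasic (N : M -> Prop) (s : int) (p : R -> Prop) : Prop :=
  ((mu_quot p N)%:Z <= (mu p)%:Z - s).

Definition basic (x : M) (p : R -> Prop) : Prop :=
  sbasic (fun z => exists r : R, z = r *: x) 1 p.

End Defs.

(* Main.v *)
Require Import Defs.
From HB Require Import structures.
From mathcomp Require Import all_boot all_order all_algebra.
From mathcomp Require Import boolp ring zify.
Import Order.TTheory GRing.Theory Num.Theory.
Local Open Scope ring_scope.
Set Implicit Arguments. Unset Strict Implicit. Unset Printing Implicit Defensive.

(* Part (1) is part (2) applied to generators of [M].  For (2), the list
   [x1, y, ys] is shortened to [x1 + a_0 y, ys_i + a_(i+1) y], keeping the
   basicness hypothesis for the shorter list; this is automatic except at the
   critical primes [p] of [Cn n], where [n + 1 - depth p] is smaller than the number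
   of generators and [mu ((M/M')_p) + n + 1 - depth p = mu M_p].
   There are finitely many of those: fix [u = depth p] and [h = mu ((M/M')_p)];
   monotonicity of [mu M] forces every point of the closed set
   [V = {q | mu ((M/M')_q) >= h}] to have depth at least [u], so the ideal of [V]
   contains a regular sequence of length [u], and the points of depth [u] in [V]
   are associated primes of the quotient by it.
   At a critical prime the generators are linearly dependent in [M (x) k(p)], and the
   span is preserved as soon as an affine form in [a], nonzero in [k(p)], does not
   vanish; a prime avoidance argument does this at all critical primes at once. *)

(** * Prime avoidance and associated primes *)

Section GeneralPosition.
Variable T : Type.
Implicit Types (p q : T -> Prop) (s : seq (T -> Prop)).

Lemma minimal_mem p s : exists2 m, m \in p :: s &
  forall q, q \in p :: s -> (forall x, q x -> m x) -> q = m.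
Proof.
elim: s p => [|q s IHs] p.
  by exists p; rewrite ?mem_head // => q; rewrite mem_seq1 => /eqP.
have [m ms minm] := IHs p; case: (pselect (forall x, q x -> m x)) => [qm|Nqm].
  exists q; rewrite ?in_cons ?eqxx ?orbT // => r.
  rewrite !in_cons orbCA => /orP[/eqP->//|rs] rq.
  have rm : r = m by apply: minm; rewrite ?in_cons // => x /rq/qm.
  by apply/predeqP => x; split=> [/rq//|/qm]; rewrite rm.
exists m => [|r]; first by move: ms; rewrite !in_cons orbCA => ->; rewrite orbT.
by rewrite !in_cons orbCA => /orP[/eqP->/Nqm//|rs]; apply: minm; rewrite in_cons.
Qed.

End GeneralPosition.

Section Ideals.
Variable R : comNzRingType.
Implicit Types I J L p q : R -> Prop.

Lemma ideal0 I : is_ideal I -> I 0. Proof. by case. Qed.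
Lemma idealD I : is_ideal I -> forall x y, I x -> I y -> I (x + y).
Proof. by case. Qed.
Lemma idealMl I : is_ideal I -> forall r x, I x -> I (r * x).
Proof. by case. Qed.
Lemma idealN I : is_ideal I -> forall x, I x -> I (- x).
Proof. by move=> idI x Ix; rewrite -mulN1r; apply: idealMl. Qed.
Lemma idealB I : is_ideal I -> forall x y, I x -> I y -> I (x - y).
Proof. by move=> idI x y Ix Iy; apply: idealD => //; apply: idealN. Qed.
Lemma idealMr I : is_ideal I -> forall r x, I x -> I (x * r).
Proof. by move=> idI r x Ix; rewrite mulrC; apply: idealMl. Qed.
Lemma ideal_sub I : is_ideal I -> forall x y, I (x - y) -> I y -> I x.
Proof. by move=> idI x y Ixy Iy; rewrite -(subrK y x); apply: idealD. Qed.

Lemma prime_is_ideal p : prime_ideal p -> is_ideal p. Proof. by case. Qed.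
Lemma primeN1 p : prime_ideal p -> ~ p 1. Proof. by case. Qed.
Lemma primeNM p : prime_ideal p -> forall x y, ~ p x -> ~ p y -> ~ p (x * y).
Proof. by case=> _ _ pM x y Nx Ny /pM[]. Qed.

(* [A] is to be thought of as a convex set, [mix r a b] being [a + r (b - a)];
   the induction removes a minimal element [m] of [s], so that some [r] outside
   [m] lies in all the other primes. *)
Lemma general_position (A : Type) (a0 : A) (mix : R -> A -> A -> A)
    (good : (R -> Prop) -> A -> Prop) (s : seq (R -> Prop)) :
  (forall p, p \in s -> prime_ideal p) ->
  (forall p, p \in s -> exists a, good p a) ->
  (forall p, p \in s -> forall r a b, p r -> good p a -> good p (mix r a b)) ->
  (forall p, p \in s -> forall r a b,
     ~ p r -> ~ good p a -> good p b -> good p (mix r a b)) ->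
  exists a, forall p, p \in s -> good p a.
Proof.
elim: {s}(size s) {-2}s (leqnn (size s)) => [|n IHn] s sz prs exg stable improve.
  by exists a0 => p; case: s sz {prs exg stable improve}.
case: s => [|p0 s] in sz prs exg stable improve *; first by exists a0.
have [m ms minm] := minimal_mem p0 s.
pose s' := [seq q <- p0 :: s | q != m].
have s's q : q \in s' -> q \in p0 :: s by rewrite mem_filter => /andP[].
have sz' : (size s' <= n)%N.
  rewrite -ltnS; apply: leq_trans sz; rewrite size_filter.
  rewrite -(count_predC (pred1 m) (p0 :: s)) -[X in (X < _)%N]add0n.
  by rewrite ltn_add2r -has_count; apply/hasP; exists m => /=.
have [|q /s's/exg //|q /s's/stable//|q /s's/improve //|a good_a] := IHn s' sz'.
  by move=> q /s's/prs.
case: (pselect (good m a)) => [gma|Nga].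
  exists a => q qs; have [->//|qm] := eqVneq q m.
  by apply: good_a; rewrite mem_filter qm.
have [b gmb] := exg _ ms.
(* By minimality of [m], each remaining prime contains an element outside [m]; as [m] is prime, the
   product of these elements stays outside [m]. *)
have [r rs' Nmr] : exists2 r, (forall q, q \in s' -> q r) & ~ m r.
  have: forall q, q \in s' -> is_ideal q /\ exists2 x, q x & ~ m x.
    move=> q; rewrite mem_filter => /andP[qm qs]; split; first exact: (prime_is_ideal (prs _ qs)).
    apply: contrapT => Nx; case/eqP: qm; apply: minm => // x qx.
    by apply: contrapT => Nmx; apply: Nx; exists x.
  elim: (s') => [|q t IHt] H; first by exists 1 => //; apply: primeN1; apply: prs.
  have [|x xt Nmx] := IHt; first by move=> u ut; apply: H; rewrite in_cons ut orbT.
  have [idq [y qy Nmy]] := H q (mem_head _ _).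
  exists (x * y); last by apply: primeNM => //; apply: prs.
  move=> u; rewrite in_cons => /orP[/eqP->|ut]; first exact: idealMl.
  by apply: idealMr; [have [] := H u; rewrite ?in_cons ?ut ?orbT|exact: xt].
exists (mix r a b) => q qs; have [->|qm] := eqVneq q m; first exact: improve.
have qs' : q \in s' by rewrite mem_filter qm.
by apply: stable; [|exact: rs'|exact: good_a].
Qed.

(** The convex set is [I] itself, with [good p x] meaning that [x] lies outside [p]. Modulo [p], the
    mixture of [a] and [b] is [a] when [r] is in [p], and [r * b] when [a] is in [p]. *)
Lemma prime_avoidance I (s : seq (R -> Prop)) : is_ideal I ->
  (forall p, p \in s -> prime_ideal p) ->
  (forall p, p \in s -> exists2 x, I x & ~ p x) ->
  exists2 x, I x & forall p, p \in s -> ~ p x.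
Proof.
move=> idI prs nsub.
have mixI (r : R) (x y : {x | I x}) : I (sval x + r * (sval y - sval x)).
  apply: idealD => //; first exact: svalP.
  by apply: idealMl => //; apply: idealB => //; apply: svalP.
have [p /nsub[x Ix Npx]|p ps r a b pr|p ps r a b Npr|a Na] :=
  @general_position _ (exist _ 0 (ideal0 idI)) (fun r x y => exist _ _ (mixI r x y))
    (fun p x => ~ p (sval x)) s prs.
- by exists (exist _ x Ix).
- move=> /= Npa; apply: contra_not Npa => H; have idp := prime_is_ideal (prs _ ps).
  rewrite -[sval a](addrK (r * (sval b - sval a))); apply: idealB => //; exact: idealMr.
- move=> /contrapT /= pa Npb; have prp := prs _ ps; have idp := prime_is_ideal prp.
  move=> H; apply: (primeNM prp Npr Npb).
  rewrite (_ : r * _ = (sval a + r * (sval b - sval a)) - (1 - r) * sval a); last by ring.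
  by apply: idealB => //; apply: idealMl.
by exists (sval a); [exact: svalP|].
Qed.

Definition colon L e : R -> Prop := fun r => L (r * e).
Definition nzd L c := forall r, L (c * r) -> L r.
(** Associated primes of [R / L]; the witness [e] lies outside [L] because [q] is proper. *)
Definition assoc L q := prime_ideal q /\ exists e, q = colon L e.
Definition adjoin J x : R -> Prop := fun r => exists c, J (r - c * x).

Lemma colon_ideal L e : is_ideal L -> is_ideal (colon L e).
Proof.
move=> idL; split=> [|x y Lx Ly|r x Lx]; rewrite /colon.
- by rewrite mul0r; apply: ideal0.
- by rewrite mulrDl; apply: idealD.
- by rewrite -mulrA; apply: idealMl.
Qed.

Lemma adjoin_ideal J x : is_ideal J -> is_ideal (adjoin J x).
Proof.
move=> idJ; split=> [|y z [c Jc] [d Jd]|r y [c Jc]].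
- by exists 0; rewrite mul0r subr0; apply: ideal0.
- by exists (c + d); rewrite mulrDl opprD addrACA; apply: idealD.
- by exists (r * c); rewrite -mulrA -mulrBr; apply: idealMl.
Qed.

Lemma sub_adjoin J x r : J r -> adjoin J x r.
Proof. by move=> Jr; exists 0; rewrite mul0r subr0. Qed.

Lemma adjoin_mem J x : is_ideal J -> adjoin J x x.
Proof. by move=> idJ; exists 1; rewrite mul1r subrr; apply: ideal0. Qed.

Implicit Type s : seq R.

Lemma ispan_ideal s : is_ideal (ispan s).
Proof.
split=> [|x y [c ->] [d ->]|r x [c ->]].
- by exists [::]; rewrite big1 // => i _; rewrite nth_nil mul0r.
- exists (mkseq (fun i => c`_i + d`_i) (size s)); rewrite -big_split /=.
  by apply: eq_bigr => i _; rewrite nth_mkseq // mulrDl.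
- exists (mkseq (fun i => r * c`_i) (size s)); rewrite mulr_sumr.
  by apply: eq_bigr => i _; rewrite nth_mkseq // mulrA.
Qed.

Lemma ispan_mem s x : x \in s -> ispan s x.
Proof.
move=> xs; exists (mkseq (fun i => (i == index x s)%:R) (size s)).
have ltx : (index x s < size s)%N by rewrite index_mem.
rewrite (bigD1 (Ordinal ltx)) //= nth_mkseq // eqxx mul1r nth_index // big1 ?addr0 // => i.
by rewrite -val_eqE /= nth_mkseq // => /negbTE ->; rewrite mul0r.
Qed.

Lemma ispan_sub I s : is_ideal I -> (forall x, x \in s -> I x) -> forall r, ispan s r -> I r.
Proof.
move=> idI sI r [c ->]; elim/big_rec: _ => [|i x _ Ix]; first exact: ideal0.
by apply: idealD => //; apply: idealMl => //; apply/sI/mem_nth.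
Qed.

Lemma ispan_rcons s x : ispan (rcons s x) = adjoin (ispan s) x.
Proof.
have idA := adjoin_ideal x (ispan_ideal s); apply/predeqP => r; split.
  apply: ispan_sub => // y; rewrite mem_rcons in_cons => /orP[/eqP->|ys].
    exact/adjoin_mem/ispan_ideal.
  exact/sub_adjoin/ispan_mem.
case=> c H; have idS := ispan_ideal (rcons s x); apply: (ideal_sub idS (y := c * x)).
  by apply: ispan_sub H => // y ys; apply: ispan_mem; rewrite mem_rcons in_cons ys orbT.
by apply: idealMl => //; apply: ispan_mem; rewrite mem_rcons mem_head.
Qed.

Section Noetherian.
Hypothesis HR : noetherian R.

(** A counterexample would lie strictly inside another one, so choice gives a strictly increasing
    chain; its union is finitely generated, hence equal to a member of the chain. *)
Lemma noetherian_ind (P : (R -> Prop) -> Prop) :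
  (forall I, is_ideal I ->
     (forall J, is_ideal J -> (forall x, I x -> J x) -> forall x, J x -> ~ I x -> P J) ->
     P I) ->
  forall I, is_ideal I -> P I.
Proof.
move=> step I0 idI0; apply: contrapT => NPI0.
pose T := {I : R -> Prop | is_ideal I /\ ~ P I}.
have next (t : T) : exists u : T, (forall x, sval t x -> sval u x) /\
    exists2 x, sval u x & ~ sval t x.
  case: t => I [idI NPI] /=; apply: contrapT => Nex; apply: NPI.
  apply: step => // J idJ IJ x Jx NIx.
  by apply: contrapT => NPJ; apply: Nex; exists (exist _ J (conj idJ NPJ)); split=> //; exists x.
have [f fP] := choice next.
pose F n := sval (iter n f (exist _ I0 (conj idI0 NPI0))).
have idF n : is_ideal (F n) by rewrite /F; case: (iter n _ _) => I [].
have Fmono m n : (m <= n)%N -> forall x, F m x -> F n x.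
  move=> /subnKC <-; elim: (n - m)%N => [|k IHk] x Fx; first by rewrite addn0.
  by rewrite addnS; apply: (fP _).1; apply: IHk.
have idU : is_ideal (fun x => exists n, F n x).
  split=> [|x y [m Fx] [n Fy]|r x [n Fx]]; first by exists 0%N; apply: ideal0.
    exists (maxn m n); apply: idealD => //.
      by apply: Fmono Fx; apply: leq_maxl.
    by apply: Fmono Fy; apply: leq_maxr.
  by exists n; apply: idealMl.
have [s sP] := HR idU.
have [n nP] : exists n, forall x, x \in s -> F n x.
  have: forall x, x \in s -> exists n, F n x by move=> x /ispan_mem /sP.
  elim: (s) => [|y t IHt] H; first by exists 0%N.
  have [|m mP] := IHt; first by move=> x xt; apply: H; rewrite in_cons xt orbT.
  have [k kP] := H y (mem_head _ _); exists (maxn m k) => x.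
  rewrite in_cons => /orP[/eqP->|/mP Fx]; first exact: Fmono (leq_maxr _ _) _ kP.
  exact: Fmono (leq_maxl _ _) _ Fx.
have [_ [x Fx NFx]] := fP (iter n f (exist _ I0 (conj idI0 NPI0))).
apply: NFx; apply: (ispan_sub (idF n) nP); apply/sP.
by exists n.+1.
Qed.

(** If [colon L r] is not prime, it contains a product [x * y] of two elements outside it; then
    [colon L (x * r)] is strictly larger, since it contains [y], and Noetherian induction
    applies. *)
Lemma assoc_above L r : is_ideal L -> ~ L r ->
  exists2 q, assoc L q & forall c, L (c * r) -> q c.
Proof.
move=> idL; move: {2}(colon L r) (erefl (colon L r)) => I defI.
have: is_ideal I by rewrite -defI; apply: colon_ideal.
move=> idI; elim/noetherian_ind: I / idI r defI => I idI IHI r defI NLr.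
case: (pselect (prime_ideal I)) => [prI|NprI].
  by exists I; [split=> //; exists r|move=> c; rewrite -defI].
have [x [y [Ixy [NIx NIy]]]] : exists x y, I (x * y) /\ ~ I x /\ ~ I y.
  apply: contrapT => Nex; apply: NprI; split=> // [|x y Ixy].
    by rewrite -defI /colon mul1r.
  by apply: contrapT => /not_orP[NIx NIy]; apply: Nex; exists x, y.
have NLxr : ~ L (x * r) by move=> Lxr; apply: NIx; rewrite -defI.
have [|||q aq qP] := IHI _ (colon_ideal (x * r) idL) _ y _ _ (x * r) erefl NLxr.
- by move=> z; rewrite -defI /colon => Lz; rewrite mulrCA; apply: idealMl.
- by move: Ixy; rewrite -defI /colon mulrA [y * x]mulrC.
- by [].
exists q => // c Lc; apply: qP; by rewrite mulrCA; apply: idealMl.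
Qed.

(** Take an associated [p = colon L e] and pass to [L + R e]. For [q = colon L f], either some
    multiple of [f] lies in [L + R e] but not in [L], which forces [q = p], or [f] has the same
    colon ideal in [L] and in [L + R e], so that [q] is associated to the latter. *)
Lemma assoc_finite L : is_ideal L ->
  exists s : seq (R -> Prop), forall q, assoc L q -> q \in s.
Proof.
elim/noetherian_ind => {}L idL IHL.
case: (pselect (exists p, assoc L p)) => [[p [prp [e defp]]]|Nex]; last first.
  by exists [::] => q aq; case: Nex; exists q.
have pE x : p x = L (x * e) by rewrite defp.
have NLe : ~ L e by move=> Le; apply: (primeN1 prp); rewrite pE mul1r.
have [s sP] := IHL _ (adjoin_ideal e idL) (@sub_adjoin L e) e (adjoin_mem e idL) NLe.
exists (p :: s) => q [prq [f defq]]; have qE x : q x = L (x * f) by rewrite defq.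
rewrite in_cons; apply/orP.
case: (pselect (exists r, adjoin L e (r * f) /\ ~ L (r * f))) => [[r [[c Lc] NLrf]]|Nex].
  left; apply/eqP; have Nqr : ~ q r by rewrite qE.
  have Npc : ~ p c.
    by rewrite pE => Lce; apply: NLrf; apply: (ideal_sub idL Lc).
  apply/predeqP => x; split=> [qx|px].
    apply: contrapT => Npx; apply: (primeNM prp Npx Npc); rewrite pE.
    have -> : x * c * e = r * (x * f) - x * (r * f - c * e) by ring.
    by apply: idealB => //; apply: idealMl => //; rewrite -qE.
  apply: contrapT => Nqx; apply: (primeNM prq Nqx Nqr); rewrite qE.
  have -> : x * r * f = x * (r * f - c * e) + c * (x * e) by ring.
  by apply: idealD => //; apply: idealMl => //; rewrite -pE.
right; apply: sP; split=> //; exists f; rewrite [LHS]defq; apply/predeqP => r.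
split; first exact: (@sub_adjoin L e (r * f)).
by move=> Lr; rewrite /colon; apply: contrapT => NLr; apply: Nex; exists r.
Qed.

(** Zero divisors modulo [L] lie in associated primes by [assoc_above], and there are finitely many
    of these to avoid. *)
Lemma common_nzd I (Ls : seq (R -> Prop)) : is_ideal I ->
  (forall L, L \in Ls -> is_ideal L) ->
  (forall L q, L \in Ls -> assoc L q -> exists2 x, I x & ~ q x) ->
  exists2 c, I c & forall L, L \in Ls -> nzd L c.
Proof.
move=> idI idLs H.
have [s [prs sP]] : exists s : seq (R -> Prop),
    (forall q, q \in s -> prime_ideal q /\ exists2 x, I x & ~ q x) /\
    forall L q, L \in Ls -> assoc L q -> q \in s.
  elim: Ls => [|L Ls IHLs] in idLs H *; first by exists [::].
  have [||s [prs sP]] := IHLs.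
  - by move=> K KLs; apply: idLs; rewrite in_cons KLs orbT.
  - by move=> K q KLs; apply: H; rewrite in_cons KLs orbT.
  have [t tP] := assoc_finite (idLs L (mem_head _ _)).
  (* The list [t] may contain other predicates than associated primes; avoidance only tolerates
     primes that do not contain [I]. *)
  exists ([seq q <- t | `[<assoc L q>]] ++ s); split=> [q|K q].
    rewrite mem_cat mem_filter => /orP[/andP[/asboolP aq _]|/prs//].
    by split; [case: aq|apply: H aq; rewrite mem_head].
  rewrite in_cons mem_cat mem_filter => /orP[/eqP->|/sP KP] aq.
    by rewrite tP // andbT; apply/orP; left; apply/asboolP.
  by rewrite KP ?orbT.
have [|q /prs[]//|c Ic cP] := prime_avoidance idI (s := s); first by move=> q /prs[].
exists c => // L LLs r Lcr; apply: contrapT => NLr.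
by have [q aq /(_ _ Lcr)] := assoc_above (idLs _ LLs) NLr; apply: cP; apply: (sP L).
Qed.

End Noetherian.
End Ideals.

(** * Depth *)

(** [natsup] is chosen by [epsilon], so its value is known only once a least upper bound is
    exhibited; an attained maximum is one. *)
Lemma natsup_eq (P : nat -> Prop) m :
  P m -> (forall k, P k -> (k <= m)%N) -> natsup P = m.
Proof.
move=> Pm maxm; have: exists m', (forall k, P k -> (k <= m')%N) /\
    forall m'', (forall k, P k -> (k <= m'')%N) -> (m' <= m'')%N.
  by exists m; split=> // m'; apply.
move=> /(ClassicalEpsilon.epsilon_spec (inhabits 0%N)); rewrite -/(natsup P) => -[ub least].
by apply/eqP; rewrite eqn_leq ub // least.
Qed.

Section LocalDepth.
Variable R : comNzRingType.
Implicit Types (I J L q : R -> Prop) (a b s : seq R).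

Section AtPrime.
Variable p : R -> Prop.
Hypothesis prp : prime_ideal p.
Let idp : is_ideal p := prime_is_ideal prp.

(** The contraction to [R] of [J R_p]. *)
Definition sat J : R -> Prop := fun r => exists t, ~ p t /\ J (t * r).

(* The ideals satisfying [plocal] are the contractions of the ideals of [R_p]. *)
Definition plocal J := is_ideal J /\ forall t r, ~ p t -> J (t * r) -> J r.

(** The contraction to [R] of [J R_p + x R_p]; computing with contractions avoids constructing
    [R_p]. *)
Definition ext J x : R -> Prop := fun r => exists t c, ~ p t /\ J (t * r - c * x).
Definition exts J a := foldl ext J a.

(* [a] is regular on [R_p / J R_p] *)
Fixpoint reg J a : Prop :=
  if a is x :: a' then [/\ p x, nzd J x & reg (ext J x) a'] else True.

(* The maximal ideal of [R_p] is associated to [R_p / L R_p]. *)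
Definition has_socle L := exists2 e, ~ L e & forall c, p c -> L (c * e).

Lemma sat_ideal J : is_ideal J -> is_ideal (sat J).
Proof.
move=> idJ; split=> [|x y [t [Npt Jt]] [u [Npu Ju]]|r x [t [Npt Jt]]].
- by exists 1; split; [exact: primeN1|rewrite mulr0; apply: ideal0].
- exists (t * u); split; first exact: primeNM.
  have -> : t * u * (x + y) = u * (t * x) + t * (u * y) by ring.
  by apply: idealD => //; apply: idealMl.
- by exists t; split=> //; rewrite mulrCA; apply: idealMl.
Qed.

Lemma plocal_sat J : is_ideal J -> plocal (sat J).
Proof.
move=> idJ; split=> [|t r Npt [u [Npu Ju]]]; first exact: sat_ideal.
by exists (u * t); split; [exact: primeNM|rewrite -mulrA].
Qed.

Lemma sat_ext J x : is_ideal J -> ext (sat J) x = sat (adjoin J x).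
Proof.
move=> idJ; apply/predeqP => r; split=> [[t [c [Npt [u [Npu Ju]]]]]|[t [Npt [c Jc]]]].
  exists (u * t); split; first exact: primeNM.
  by exists (u * c); rewrite -!mulrA -mulrBr.
exists t, c; split=> //; exists 1; split; first exact: primeN1.
by rewrite mul1r.
Qed.

Lemma ext_ideal J x : is_ideal J -> is_ideal (ext J x).
Proof.
move=> idJ; split=> [|y z [t [c [Npt Jt]]] [u [d [Npu Ju]]]|r y [t [c [Npt Jt]]]].
- exists 1, 0; split; first exact: primeN1.
  by rewrite mulr0 mul0r subr0; apply: ideal0.
- exists (t * u), (u * c + t * d); split; first exact: primeNM.
  have -> : t * u * (y + z) - (u * c + t * d) * x =
    u * (t * y - c * x) + t * (u * z - d * x) by ring.
  by apply: idealD => //; apply: idealMl.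
- exists t, (r * c); split=> //.
  by rewrite mulrCA -mulrA -mulrBr; apply: idealMl.
Qed.

Lemma plocal_ext J x : plocal J -> plocal (ext J x).
Proof.
move=> [idJ _]; split=> [|t r Npt [u [c [Npu Ju]]]]; first exact: ext_ideal.
by exists (u * t), c; split; [exact: primeNM|rewrite -mulrA].
Qed.

Lemma sub_ext J x r : J r -> ext J x r.
Proof. by move=> Jr; exists 1, 0; split; [exact: primeN1|rewrite mul1r mul0r subr0]. Qed.

Lemma ext_mem J x : is_ideal J -> ext J x x.
Proof.
move=> idJ; exists 1, 1; split; first exact: primeN1.
by rewrite subrr; apply: ideal0.
Qed.

Lemma ext_sub J L x : plocal L -> (forall r, J r -> L r) -> L x ->
  forall r, ext J x r -> L r.
Proof.
move=> [idL Ll] JL Lx r [t [c [Npt /JL Lt]]]; apply: (Ll t) => //.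
by apply: (ideal_sub idL Lt); apply: idealMl.
Qed.

Lemma ext_swap J x y : plocal J -> ext (ext J x) y = ext (ext J y) x.
Proof.
move=> lJ; suff H z w r : ext (ext J z) w r -> ext (ext J w) z r.
  by apply/predeqP => r; split; apply: H.
have lE := plocal_ext z (plocal_ext w lJ).
apply: ext_sub => //; last by apply/sub_ext/ext_mem; case: lJ.
apply: ext_sub => //; last by apply/ext_mem/ext_ideal; case: lJ.
by move=> u Ju; apply/sub_ext/sub_ext.
Qed.

Lemma plocal_exts J a : plocal J -> plocal (exts J a).
Proof. by elim: a J => //= x a IHa J /(plocal_ext x)/IHa. Qed.

Lemma exts_rcons J a x : exts J (rcons a x) = ext (exts J a) x.
Proof. by rewrite /exts -cats1 foldl_cat. Qed.

Lemma exts_swap J a x : plocal J -> exts (ext J x) a = ext (exts J a) x.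
Proof.
elim: a J => //= y a IHa J lJ.
by rewrite ext_swap // IHa //; apply: plocal_ext.
Qed.

Lemma reg_rcons J a x :
  reg J (rcons a x) <-> [/\ reg J a, p x & nzd (exts J a) x].
Proof.
elim: a J => [|y a IHa] J /=; first by split=> [[]|[]].
split=> [[py yJ /IHa[]]|[[py yJ ra] px xJ]]; first by split.
by split=> //; apply/IHa.
Qed.

Lemma nzdN_socle L c : p c -> nzd L c -> ~ has_socle L.
Proof. by move=> pc Lc [e NLe /(_ _ pc)/Lc]. Qed.

(* One-step exchange: if [y e = x f] modulo [J], then [e] is a socle element modulo
   [J + (x)] exactly when [f] is one modulo [J + (y)]. *)
Lemma socle_exchange J x y : plocal J -> p y -> nzd J x -> nzd J y ->
  has_socle (ext J x) -> has_socle (ext J y).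
Proof.
move=> [idJ lJ] py Jx Jy [e Ne eP].
have [t [f [Npt Jf]]] := eP _ py; exists f => [[u [g [Npu Jg]]]|c pc].
  apply: Ne; exists (u * t), g; split; first exact: primeNM.
  apply: Jy; have -> : y * (u * t * e - g * x) =
    u * (t * (y * e) - f * x) + x * (u * f - g * y) by ring.
  by apply: idealD => //; apply: idealMl.
have [u [g [Npu Jg]]] := eP _ pc; exists u, (t * g); split=> //.
apply: Jx; have -> : x * (u * (c * f) - t * g * y) =
  t * y * (u * (c * e) - g * x) - u * c * (t * (y * e) - f * x) by ring.
by apply: idealB => //; apply: idealMl.
Qed.

Fixpoint prefixes J a : seq (R -> Prop) :=
  J :: if a is x :: a' then prefixes (ext J x) a' else [::].

Lemma prefixes_head J a : J \in prefixes J a.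
Proof. by case: a => [|x a]; rewrite /= mem_head. Qed.

Lemma prefixes_last J a : exts J a \in prefixes J a.
Proof. by elim: a J => [|x a IHa] J; rewrite /= in_cons ?IHa ?orbT ?eqxx. Qed.

Lemma prefixes_plocal J a L : plocal J -> L \in prefixes J a -> plocal L.
Proof.
elim: a J => [|x a IHa] J lJ /=; rewrite in_cons => /orP[/eqP->//|] //.
by apply: IHa; apply: plocal_ext.
Qed.

(** The term following the initial segment is a nonzerodivisor modulo it, yet lies in [p] and so
    would kill a socle element. *)
Lemma prefixesN_socle J a x L : reg J (rcons a x) -> L \in prefixes J a -> ~ has_socle L.
Proof.
elim: a J => [|y a IHa] J /=.
  by move=> [px Jx _]; rewrite mem_seq1 => /eqP->; apply: nzdN_socle Jx.
by move=> [py Jy ra]; rewrite in_cons => /orP[/eqP->|]; [apply: nzdN_socle Jy|apply: IHa].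
Qed.

(** Up to factors outside [p]: if [x * r = s * c] modulo [J], then [s] lies in [J + (x)], say
    [s = g * x], and cancelling [x] leaves [r = g * c]. *)
Lemma nzd_swap J x c : plocal J -> nzd J x -> nzd (ext J x) c -> nzd (ext J c) x.
Proof.
move=> [idJ lJ] Jx Jxc r [t [s [Npt Js]]].
have [u [g [Npu Jg]]] : ext J x s.
  apply: Jxc; exists 1, (t * r); split; first exact: primeN1.
  have -> : 1 * (c * s) - t * r * x = - (t * (x * r) - s * c) by ring.
  exact: idealN.
exists (u * t), g; split; first exact: primeNM.
apply: Jx; have -> : x * (u * t * r - g * c) =
  u * (t * (x * r) - s * c) + c * (u * s - g * x) by ring.
by apply: idealD => //; apply: idealMl.
Qed.

Lemma reg_swap J a c : plocal J -> reg J a -> (forall L, L \in prefixes J a -> nzd L c) ->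
  reg (ext J c) a.
Proof.
elim: a J => //= x a IHa J lJ [px Jx ra] H.
have lJx := plocal_ext x lJ; split=> //.
  by apply: nzd_swap => //; apply: H; rewrite in_cons prefixes_head orbT.
rewrite ext_swap //; apply: IHa => // L La.
by apply: H; rewrite in_cons La orbT.
Qed.

(** If [p] were contained in [q = colon L e], then [e] would be a socle element. *)
Lemma assoc_plocal L q : plocal L -> assoc L q -> ~ has_socle L -> exists2 x, p x & ~ q x.
Proof.
move=> [idL lL] [prq [e qE]] NsL; apply: contrapT => Nex; apply: NsL.
have pq x : p x -> q x by move=> px; apply: contrapT => Nqx; apply: Nex; exists x.
exists e => [Le|c /pq]; last by rewrite qE.
by apply: (primeN1 prq); rewrite qE /colon mul1r.
Qed.

(** * Maximal regular sequences all have the same length *)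

Section Noetherian.
Hypothesis HR : noetherian R.

Lemma common_nzd_plocal (Ls : seq (R -> Prop)) :
  (forall L, L \in Ls -> plocal L /\ ~ has_socle L) ->
  exists2 c, p c & forall L, L \in Ls -> nzd L c.
Proof.
move=> H; apply: common_nzd => // [L /H[[]]//|L q /H[lL NsL] aq].
exact: assoc_plocal aq NsL.
Qed.

(* Rees: an element regular modulo all proper initial segments of both sequences
   can be exchanged for the last term of each, then moved to the front. *)
Lemma socle_reg J a b : plocal J -> size a = size b -> reg J a -> reg J b ->
  has_socle (exts J a) -> has_socle (exts J b).
Proof.
move sz: (size a) => n.
elim: n => [|n IHn] in J a b sz *.
  by move/size0nil: sz => -> _ /esym/size0nil ->.
case/lastP: a sz => // a x; rewrite size_rcons => -[sza].
case/lastP: b => // b y; rewrite size_rcons => lJ -[szb] ra rb.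
have [|c pc cP] := @common_nzd_plocal (prefixes J a ++ prefixes J b).
  move=> L; rewrite mem_cat => /orP[] LP; (split; first exact: prefixes_plocal lJ LP).
    exact: prefixesN_socle ra LP.
  exact: prefixesN_socle rb LP.
have cPa L : L \in prefixes J a -> nzd L c by move=> La; apply: cP; rewrite mem_cat La.
have cPb L : L \in prefixes J b -> nzd L c by move=> Lb; apply: cP; rewrite mem_cat Lb orbT.
move: ra rb; rewrite !reg_rcons !exts_rcons => -[ra px xP] [rb py yP] sa.
(* The last terms [x] and [y] are both exchanged for [c]; with [c] in front, the induction
   hypothesis over [ext J c] compares the two shorter sequences. *)
have {}sa := socle_exchange (plocal_exts a lJ) pc xP (cPa _ (prefixes_last _ _)) sa.
apply: (socle_exchange (plocal_exts b lJ) py (cPb _ (prefixes_last _ _)) yP).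
move: sa; rewrite -!exts_swap //.
by apply: IHn => //; [exact: plocal_ext|exact: reg_swap..].
Qed.

Lemma reg_take J a k : reg J a -> reg J (take k a).
Proof. by elim: a J k => [|x a IHa] J [|k] //= [px Jx /IHa]. Qed.

(** Otherwise the initial segment of [b] of length [size a] inherits the socle by [socle_reg],
    although the next term of [b] is a nonzerodivisor in [p] modulo it. *)
Lemma reg_size_le J a b : plocal J -> reg J a -> has_socle (exts J a) -> reg J b ->
  (size b <= size a)%N.
Proof.
move=> lJ ra sa rb; rewrite leqNgt; apply/negP => lt_ab.
have szt : size a = size (take (size a) b) by rewrite size_takel // ltnW.
have := reg_take (size a).+1 rb; rewrite (take_nth 0) // reg_rcons => -[rt px /(nzdN_socle px)].
by apply; apply: socle_reg sa.
Qed.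

(** Without a socle, [p] contains a nonzerodivisor [c] modulo [J], and Noetherian induction
    continues with the strictly larger ideal [ext J c], which is still contained in [p]. *)
Lemma maximal_reg J : plocal J -> ~ J 1 -> exists2 a, reg J a & has_socle (exts J a).
Proof.
move=> lJ; have idJ := lJ.1; elim/noetherian_ind: J / idJ lJ => // J idJ IHJ lJ NJ1.
have [sJ|NsJ] := pselect (has_socle J); first by exists [::].
have [|c pc cP] := @common_nzd_plocal [:: J]; first by move=> L; rewrite mem_seq1 => /eqP->.
have {}cP : nzd J c by apply: cP; rewrite mem_head.
have Jp r : J r -> p r.
  by move=> Jr; apply: contrapT => Npr; apply: NJ1; apply: (lJ.2 r) => //; rewrite mulr1.
have [||||||a ra sa] := IHJ (ext J c) _ _ c.
- exact: ext_ideal.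
- by move=> x; apply: sub_ext.
- exact: ext_mem.
- by move=> Jc; apply: NJ1; apply: cP; rewrite mulr1.
- exact: plocal_ext.
- move=> [t [d [Npt /Jp]]]; rewrite mulr1 => ptd; apply: Npt.
  by apply: (ideal_sub idp ptd); apply: idealMl.
by exists (c :: a).
Qed.

(** The kernel of [R -> R_p], standing for the zero ideal of [R_p]. *)
Definition zero_sat := sat (ispan [::]).

Lemma plocal_zero_sat : plocal zero_sat.
Proof. exact/plocal_sat/ispan_ideal. Qed.

Lemma exts_zero_sat a : exts zero_sat a = sat (ispan a).
Proof.
elim/last_ind: a => // a x IHa.
rewrite exts_rcons IHa sat_ext; last exact: ispan_ideal.
by rewrite ispan_rcons.
Qed.

Lemma loc_regular_seqE a : loc_regular_seq p a <-> reg zero_sat a.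
Proof.
elim/last_ind: a => [|a x IHa]; first by split=> // _; split.
rewrite (propext (reg_rcons _ _ _)) -(propext IHa) exts_zero_sat; have nthE i : (i < size a)%N ->
    (rcons a x)`_i = a`_i /\ take i (rcons a x) = take i a.
  by move=> lti; rewrite nth_rcons lti -cats1 takel_cat // ltnW.
have ltS i : (i < size a)%N -> (i < size (rcons a x))%N by rewrite size_rcons => /ltnW.
have lta : (size a < size (rcons a x))%N by rewrite size_rcons.
have takea : take (size a) (rcons a x) = a by rewrite -cats1 take_size_cat.
have ntha : (rcons a x)`_(size a) = x by rewrite nth_rcons ltnn eqxx.
split=> [[pa ra]|[[pa ra] px xP]].
  split; first (split=> i lti; have [na ta] := nthE i lti).
  - by rewrite -na; apply/pa/ltS.
  - by rewrite -na -ta; apply/ra/ltS.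
  - by rewrite -ntha; apply: pa.
  - by move=> r; have := ra _ lta r; rewrite takea ntha.
split=> i; rewrite size_rcons ltnS leq_eqVlt => /orP[/eqP->|lti].
- by rewrite ntha.
- by have [-> _] := nthE i lti; apply: pa.
- by rewrite ntha takea.
- by have [-> ->] := nthE i lti; apply: ra.
Qed.

(** The socle makes [a] a longest regular sequence by [reg_size_le], so the supremum is attained. *)
Lemma depth_eq a : reg zero_sat a -> has_socle (exts zero_sat a) -> depth p = size a.
Proof.
move=> ra sa; apply: natsup_eq => [|k [b [<- /loc_regular_seqE rb]]].
  by exists a; split=> //; apply/loc_regular_seqE.
exact: reg_size_le plocal_zero_sat ra sa rb.
Qed.

Lemma depth_max : exists2 a, reg zero_sat a & has_socle (exts zero_sat a).
Proof.
apply: maximal_reg; first exact: plocal_zero_sat.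
move=> [t [Npt [c]]]; rewrite big_ord0 mulr1 => t0; apply: Npt; rewrite t0.
exact: ideal0.
Qed.

Lemma depth_socle a : reg zero_sat a -> size a = depth p -> has_socle (exts zero_sat a).
Proof.
move=> ra sza; have [b rb sb] := depth_max.
apply: (socle_reg plocal_zero_sat _ rb ra sb).
by rewrite sza (depth_eq rb).
Qed.

End Noetherian.
End AtPrime.

(** * Points of minimal depth in a closed set *)

Section ClosedSet.
Hypothesis HR : noetherian R.

(** Regularity on [R] itself, with no condition that the quotient be nonzero; it passes to [R_p] for
    every prime [p] containing the terms. *)
Definition weakly_regular a :=
  forall i, (i < size a)%N -> nzd (ispan (take i a)) a`_i.

Lemma weakly_regular_loc p a : prime_ideal p -> weakly_regular a ->
  (forall x, x \in a -> p x) -> reg p (zero_sat p) a.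
Proof.
move=> prp wa ap; apply/loc_regular_seqE => //; split=> i lti; first exact/ap/mem_nth.
move=> r [t [Npt tP]]; exists t; split=> //.
by apply: (wa i lti); rewrite mulrCA.
Qed.

(* A weakly regular sequence of length [u] in the radical ideal [I] of the closed
   set [V(S)] makes every point of depth [u] of [V(S)] associated to it. *)
Lemma finite_depth_locus (S : R -> Prop) u :
  (forall q, prime_ideal q -> (forall x, S x -> q x) -> (u <= depth q)%N) ->
  exists s : seq (R -> Prop),
    forall p, prime_ideal p -> (forall x, S x -> p x) -> depth p = u -> p \in s.
Proof.
move=> minu; pose I r := forall q, prime_ideal q -> (forall x, S x -> q x) -> q r.
have idI : is_ideal I.
  split=> [|x y Ix Iy|r x Ix] q prq Sq; have idq := prime_is_ideal prq.
  - exact: ideal0.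
  - by apply: idealD; [|exact: Ix|exact: Iy].
  - by apply: idealMl; [|exact: Ix].
have [a [sza aI wa]] : exists a, [/\ size a = u, forall x, x \in a -> I x & weakly_regular a].
  move: (leqnn u); elim: {1 3}u => [|n IHn] ltn; first by exists [::].
  have [a [sza aI wa]] := IHn (ltnW ltn).
  (* A next term exists: an associated prime of [ispan a] containing [I] would be a point of the
     closed set whose depth is [size a], which is less than [u]. *)
  have [L|L q|c Ic cP] := common_nzd HR (I := I) (Ls := [:: ispan a]) idI.
  - by rewrite mem_seq1 => /eqP->; apply: ispan_ideal.
  - rewrite mem_seq1 => /eqP-> [prq [e qE]]; apply: contrapT => Nex.
    have Iq x : I x -> q x by move=> Ix; apply: contrapT => Nqx; apply: Nex; exists x.
    have ra := weakly_regular_loc prq wa (fun x xa => Iq x (aI x xa)).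
    have sa : has_socle q (exts q (zero_sat q) a).
      rewrite exts_zero_sat //; exists e => [[t [Nqt Lt]]|c qc]; first by apply: Nqt; rewrite qE.
      by exists 1; split; [exact: primeN1|move: qc; rewrite mul1r qE].
    have := minu q prq _; rewrite (depth_eq prq HR ra sa) sza leqNgt ltn => /(_ _)/negP.
    by apply=> // x Sx; apply: Iq => r _ /(_ _ Sx).
  exists (rcons a c); split=> [|x|i].
  - by rewrite size_rcons sza.
  - by rewrite mem_rcons in_cons => /orP[/eqP->//|/aI].
  rewrite size_rcons ltnS leq_eqVlt => /orP[/eqP->|lti].
    by rewrite nth_rcons ltnn eqxx -cats1 take_size_cat //; apply: cP; rewrite mem_head.
  by rewrite nth_rcons lti -cats1 takel_cat ?(ltnW lti) //; apply: wa.
have [s sP] := assoc_finite HR (ispan_ideal a); exists s => p prp Sp dp.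
have ra := weakly_regular_loc prp wa (fun x xa => aI x xa p prp Sp).
have := depth_socle prp HR ra; rewrite sza dp exts_zero_sat // => /(_ erefl)[e Ne eP].
have idp := prime_is_ideal prp; have idL := ispan_ideal a; have [g gP] := HR idp.
(* As [p] is finitely generated, one [t] outside [p] clears the denominators of all products
   [x * e]; then [p] is the colon ideal of [t * e]. *)
have [t Npt tP] : exists2 t, ~ p t & forall x, x \in g -> ispan a (t * (x * e)).
  have: forall x, x \in g -> sat p (ispan a) (x * e) by move=> x /ispan_mem/gP/eP.
  elim: (g) => [|x h IHh] H; first by exists 1 => //; apply: primeN1.
  have [|t Npt tP] := IHh; first by move=> y yh; apply: H; rewrite in_cons yh orbT.
  have [v [Npv vP]] := H x (mem_head _ _); exists (t * v); first exact: primeNM.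
  move=> y; rewrite in_cons => /orP[/eqP->|/tP]; first by rewrite -mulrA; apply: idealMl.
  by rewrite [t * v]mulrC -mulrA; apply: idealMl.
apply: sP; split=> //; exists (t * e); apply/predeqP => r; split=> [/gP|Lr].
  apply: ispan_sub; first exact: colon_ideal.
  by move=> x /tP; rewrite /colon mulrCA.
apply: contrapT => Npr; apply: Ne; exists (r * t); split; first exact: primeNM.
by rewrite -mulrA.
Qed.

End ClosedSet.
End LocalDepth.

(** * Minimal numbers of generators *)

Lemma natmin_spec (P : nat -> Prop) k : P k ->
  P (natmin P) /\ forall m, P m -> (natmin P <= m)%N.
Proof.
move=> Pk; apply: (ClassicalEpsilon.epsilon_spec (inhabits 0%N)
  (fun m => P m /\ forall k, P k -> (m <= k)%N)).
have exP : exists m, `[<P m>] by exists k; apply/asboolP.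
exists (ex_minn exP); case: ex_minnP => m /asboolP Pm minm.
by split=> // j /asboolP/minm.
Qed.

Section Submodules.
Variables (R : comNzRingType) (M : lmodType R).
Implicit Types (N K : M -> Prop) (x y z : M) (s g : seq M).

Definition submod N :=
  [/\ N 0, forall x y, N x -> N y -> N (x + y) & forall r x, N x -> N (r *: x)].

Lemma submod0 N : submod N -> N 0. Proof. by case. Qed.
Lemma submodD N : submod N -> forall x y, N x -> N y -> N (x + y).
Proof. by case. Qed.
Lemma submodZ N : submod N -> forall r x, N x -> N (r *: x).
Proof. by case. Qed.
Lemma submodN N : submod N -> forall x, N x -> N (- x).
Proof. by move=> sN x Nx; rewrite -scaleN1r; apply: submodZ. Qed.
Lemma submodB N : submod N -> forall x y, N x -> N y -> N (x - y).
Proof. by move=> sN x y Nx Ny; apply: submodD => //; apply: submodN. Qed.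
Lemma submod_sub N : submod N -> forall x y, N (x - y) -> N y -> N x.
Proof. by move=> sN x y Nxy Ny; rewrite -(subrK y x); apply: submodD. Qed.
Lemma submod_sum N : submod N -> forall n (F : 'I_n -> M),
  (forall i, N (F i)) -> N (\sum_i F i).
Proof.
move=> sN n F NF; elim/big_rec: _ => [|i x _ Nx]; first exact: submod0.
exact: submodD.
Qed.

Definition zero_sub : M -> Prop := fun z => z = 0.

Lemma submod_zero : submod zero_sub.
Proof. by split=> [|x y -> ->|r x ->]; rewrite /zero_sub ?addr0 ?scaler0. Qed.

Lemma zero_sub_sub N : submod N -> forall x, zero_sub x -> N x.
Proof. by move=> sN x ->; apply: submod0. Qed.

Lemma submod_mspan s : submod (mspan s).
Proof.
split=> [|x y [c ->] [d ->]|r x [c ->]].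
- by exists [::]; rewrite big1 // => i _; rewrite nth_nil scale0r.
- exists (mkseq (fun i => c`_i + d`_i) (size s)); rewrite -big_split /=.
  by apply: eq_bigr => i _; rewrite nth_mkseq // scalerDl.
- exists (mkseq (fun i => r * c`_i) (size s)); rewrite scaler_sumr.
  by apply: eq_bigr => i _; rewrite nth_mkseq // scalerA.
Qed.

Lemma mspan_mem s x : x \in s -> mspan s x.
Proof.
move=> xs; exists (mkseq (fun i => (i == index x s)%:R) (size s)).
have ltx : (index x s < size s)%N by rewrite index_mem.
rewrite (bigD1 (Ordinal ltx)) //= nth_mkseq // eqxx scale1r nth_index // big1 ?addr0 // => i.
by rewrite -val_eqE /= nth_mkseq // => /negbTE ->; rewrite scale0r.
Qed.

Lemma mspan_sub N s : submod N -> (forall x, x \in s -> N x) -> forall y, mspan s y -> N y.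
Proof.
move=> sN sNs y [c ->]; apply: submod_sum => // i.
by apply: submodZ => //; apply/sNs/mem_nth.
Qed.

Definition addv N x : M -> Prop := fun y => exists r, N (y - r *: x).

(* in the form in which [mu_quot] adds generators to a submodule *)
Definition adds N g : M -> Prop := fun y => exists z, N z /\ mspan g (y - z).

Lemma submod_addv N x : submod N -> submod (addv N x).
Proof.
move=> sN; split=> [|y z [r Nr] [t Nt]|r y [t Nt]].
- by exists 0; rewrite scale0r subr0; apply: submod0.
- by exists (r + t); rewrite scalerDl opprD addrACA; apply: submodD.
- by exists (r * t); rewrite -scalerA -scalerBr; apply: submodZ.
Qed.

Lemma addv_mem N x : submod N -> addv N x x.
Proof. by move=> sN; exists 1; rewrite scale1r subrr; apply: submod0. Qed.

Lemma sub_addv N x y : N y -> addv N x y.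
Proof. by move=> Ny; exists 0; rewrite scale0r subr0. Qed.

Lemma addv_sub N K x : submod K -> (forall y, N y -> K y) -> K x ->
  forall y, addv N x y -> K y.
Proof.
move=> sK NK Kx y [r /NK Kr]; apply: (submod_sub sK Kr); exact: submodZ.
Qed.

Lemma submod_adds N g : submod N -> submod (adds N g).
Proof.
move=> sN; have sg := submod_mspan g; split=> [|y z [u [Nu gu]] [v [Nv gv]]|r y [u [Nu gu]]].
- by exists 0; rewrite subrr; split; [exact: submod0|exact: submod0].
- by exists (u + v); rewrite opprD addrACA; split; exact: submodD.
- by exists (r *: u); rewrite -scalerBr; split; exact: submodZ.
Qed.

Lemma sub_adds N g y : N y -> adds N g y.
Proof. by move=> Ny; exists y; rewrite subrr; split=> //; exact: submod0 (submod_mspan g). Qed.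

Lemma adds_mem N g x : submod N -> x \in g -> adds N g x.
Proof. by move=> sN xg; exists 0; rewrite subr0; split; [apply: submod0|apply: mspan_mem]. Qed.

Lemma adds_sub N K g : submod K -> (forall y, N y -> K y) -> (forall x, x \in g -> K x) ->
  forall y, adds N g y -> K y.
Proof.
move=> sK NK gK y [z [/NK Kz /(mspan_sub sK gK) Kyz]]; exact: (submod_sub sK Kyz).
Qed.

Lemma adds_zero g : adds zero_sub g = mspan g.
Proof.
apply/predeqP => y; split=> [[z [->]]|gy]; first by rewrite subr0.
by exists 0; rewrite subr0.
Qed.

Lemma adds_nil N : submod N -> adds N [::] = N.
Proof.
move=> sN; apply/predeqP => y; split; last exact: sub_adds.
by apply: adds_sub => // x; rewrite in_nil.
Qed.

Lemma adds_cons N x g : submod N -> adds N (x :: g) = adds (addv N x) g.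
Proof.
move=> sN; have sx := submod_addv x sN; apply/predeqP => y; split.
  apply: adds_sub; first exact: submod_adds.
    by move=> z Nz; apply/sub_adds/sub_addv.
  move=> z; rewrite in_cons => /orP[/eqP->|]; last exact: adds_mem.
  exact/sub_adds/addv_mem.
have sA := submod_adds (x :: g) sN; apply: adds_sub => //.
  apply: addv_sub => //; first by move=> z; apply: sub_adds.
  by apply: adds_mem; rewrite ?mem_head.
by move=> z zg; apply: adds_mem; rewrite // in_cons zg orbT.
Qed.

Lemma adds_perm N g g' : submod N -> g =i g' -> adds N g = adds N g'.
Proof.
move=> sN gg'; suff H h h' y : h =i h' -> adds N h y -> adds N h' y.
  by apply/predeqP => y; split; apply: H => // z; rewrite gg'.
move=> hh'; apply: adds_sub; [exact: submod_adds|by move=> z; apply: sub_adds|].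
by move=> z zh; apply: adds_mem; rewrite // -hh'.
Qed.

(** * Generation in the localization and in the residue space *)

Section AtPrime.
Variable p : R -> Prop.
Hypothesis prp : prime_ideal p.
Let idp : is_ideal p := prime_is_ideal prp.

Definition mloc N : M -> Prop := fun y => exists u, ~ p u /\ N (u *: y).

(** The submodule [p M], taken as an intersection so that no finite sums have to be handled. *)
Definition pM : M -> Prop := fun y =>
  forall K, submod K -> (forall r x, p r -> K (r *: x)) -> K y.

(* [y] lies in the span of [N] in the residue space [M (x) k(p)] *)
Definition clos N := mloc (fun y => exists z, N z /\ pM (y - z)).

Lemma submod_mloc N : submod N -> submod (mloc N).
Proof.
move=> sN; split=> [|x y [t [Npt Nt]] [u [Npu Nu]]|r x [t [Npt Nt]]].
- by exists 1; rewrite scaler0; split; [exact: primeN1|exact: submod0].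
- exists (t * u); split; first exact: primeNM.
  rewrite scalerDr -[X in _ + X]scalerA mulrC -scalerA.
  by apply: submodD => //; apply: submodZ.
- by exists t; split=> //; rewrite scalerA mulrC -scalerA; apply: submodZ.
Qed.

Lemma submod_pM : submod pM.
Proof.
split=> [K sK _|x y px py K sK KP|r x px K sK KP]; first exact: submod0.
  by apply: submodD => //; [apply: px|apply: py].
by apply: submodZ => //; apply: px.
Qed.

Lemma submod_clos N : submod N -> submod (clos N).
Proof.
move=> sN; apply: submod_mloc; have sp := submod_pM.
split=> [|y z [u [Nu gu]] [v [Nv gv]]|r y [u [Nu gu]]].
- by exists 0; rewrite subrr; split; [exact: submod0|exact: (submod0 sp)].
- by exists (u + v); rewrite opprD addrACA; split; [exact: submodD|exact: (submodD sp)].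
- by exists (r *: u); rewrite -scalerBr; split; [exact: submodZ|exact: (submodZ sp)].
Qed.

Lemma mloc_clos N y : mloc N y -> clos N y.
Proof.
case=> u [Npu Nu]; exists u; split=> //; exists (u *: y); rewrite subrr.
by split; last exact: (submod0 submod_pM).
Qed.

Lemma sub_mloc N y : N y -> mloc N y.
Proof. by move=> Ny; exists 1; rewrite scale1r; split; first exact: primeN1. Qed.

Lemma sub_clos N y : N y -> clos N y.
Proof. by move=> Ny; apply/mloc_clos/sub_mloc. Qed.

Lemma closZ N u y : ~ p u -> clos N (u *: y) -> clos N y.
Proof.
by move=> Npu [v [Npv vP]]; exists (v * u); split; [exact: primeNM|rewrite -scalerA].
Qed.

Lemma clos_sub N K : submod K -> (forall y, N y -> clos K y) -> forall y, clos N y -> clos K y.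
Proof.
move=> sK NK y [u [Npu [z [/NK Kz pz]]]]; have sc := submod_clos sK.
apply: (closZ Npu); apply: (submod_sub sc _ Kz).
by apply: sub_mloc; exists 0; split; [exact: submod0|rewrite subr0].
Qed.

Lemma closS N K : submod K -> (forall y, N y -> K y) -> forall y, clos N y -> clos K y.
Proof. by move=> sK NK; apply: clos_sub => // y /NK; apply: sub_clos. Qed.

(** The coefficient of [y] in an expression of [x] lies outside [p], since otherwise [x] would be in
    the span of [N] already; so the expression can be solved for [y]. *)
Lemma clos_addv_exchange N x y : submod N -> clos (addv N y) x -> ~ clos N x -> clos (addv N x) y.
Proof.
move=> sN [u [Npu [z [[r Nr] pz]]]] Nx.
have sc := submod_clos sN; have sx := submod_clos (submod_addv x sN).
have ux : clos N (u *: x - r *: y).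
  apply: sub_mloc; exists (z - r *: y); split=> //.
  by rewrite opprB addrA subrK.
have Npr : ~ p r.
  move=> pr; apply: Nx; apply: (closZ Npu); apply: (submod_sub sc ux).
  apply: sub_mloc; exists 0; split; first exact: submod0.
  by rewrite subr0 => K sK; apply.
apply: (closZ Npr); have -> : r *: y = u *: x - (u *: x - r *: y) by rewrite opprB addrC subrK.
apply: submodB => //; first by apply: submodZ => //; apply/sub_clos/addv_mem.
by apply: closS ux; [exact: submod_addv|move=> w; apply: sub_addv].
Qed.

(** Induction on the generators of [M] modulo [N] gives [M_p = N_p + R_p x]. Then [p M] lies locally
    in [N + p x], and expressing [x] modulo [p M] puts [(v * u - r) *: x] in [N], with [r] in [p]
    and [v * u] outside. *)
Lemma nakayama_adds N s : submod N -> (forall y, mloc (adds N s) y) -> (forall y, clos N y) ->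
  forall y, mloc N y.
Proof.
elim: s N => [|x s IHs] N sN; first by rewrite adds_nil.
rewrite adds_cons // => sP cP; have sx := submod_addv x sN.
have {sP IHs} xP : forall y, mloc (addv N x) y.
  by apply: IHs => // y; apply: closS (cP y) => // z; apply: sub_addv.
pose K := mloc (fun y => exists r, p r /\ N (y - r *: x)).
have sK : submod K.
  apply: submod_mloc; split=> [|y z [r [pr Nr]] [t [pt Nt]]|r y [t [pt Nt]]].
  - by exists 0; rewrite scale0r subr0; split; [exact: ideal0|exact: submod0].
  - exists (r + t); rewrite scalerDl opprD addrACA.
    by split; [apply: idealD|apply: submodD].
  - by exists (r * t); rewrite -scalerA -scalerBr; split; [apply: idealMl|apply: submodZ].
have [u [Npu [z [Nz]]]] := cP x.
have KP r m : p r -> K (r *: m).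
  move=> pr; have [v [Npv [t Nt]]] := xP m; exists v; split=> //.
  exists (r * t); split; first exact: idealMr.
  by rewrite scalerA mulrC -!scalerA -scalerBr; apply: submodZ.
move=> /(_ K sK KP)[v [Npv [r [pr Nr]]]].
have Nx : N ((v * u - r) *: x).
  rewrite scalerBl -scalerA; apply: (submod_sub sN _ (submodZ sN v Nz)).
  by move: Nr; rewrite scalerBr addrAC.
have Npvu : ~ p (v * u - r) by move=> /(ideal_sub idp)/(_ pr); apply: primeNM.
move=> y; have [t [Npt [c Nc]]] := xP y.
exists ((v * u - r) * t); split; first exact: primeNM.
apply: (submod_sub sN (y := c *: ((v * u - r) *: x))); last exact: submodZ.
by rewrite scalerA [c * _]mulrC -!scalerA -scalerBr; apply: submodZ.
Qed.

Section Generators.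
Variable e : seq M.
Hypothesis eP : forall x, mspan e x.

Lemma nakayama N : submod N -> (forall y, clos N y) -> forall y, mloc N y.
Proof.
move=> sN; apply: (nakayama_adds (s := e)) => // y.
by apply: sub_mloc; exists 0; split; [exact: submod0|rewrite subr0].
Qed.

Lemma mu_quot_spec N g : (forall y, mloc (adds N g) y) ->
  (exists h, size h = mu_quot p N /\ forall y, mloc (adds N h) y) /\
  (mu_quot p N <= size g)%N.
Proof.
move=> gP; pose P m := exists h, size h = m /\ forall y, mloc (adds N h) y.
have Pg : P (size g) by exists g.
by have [Pm minm] := natmin_spec Pg; split; [exact: Pm|exact: minm].
Qed.

Lemma mu_quot_gen N : submod N ->
  exists g, size g = mu_quot p N /\ forall y, clos (adds N g) y.
Proof.
move=> sN; have [y|[g [szg gP]] _] := @mu_quot_spec N e.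
  by apply: sub_mloc; exists 0; split; [exact: submod0|rewrite subr0].
by exists g; split=> // y; apply/mloc_clos/gP.
Qed.

(** By Nakayama, generation may be tested in the residue space. *)
Lemma mu_quot_le N g : submod N -> (forall y, clos (adds N g) y) -> (mu_quot p N <= size g)%N.
Proof. by move=> sN /(nakayama (submod_adds g sN))/mu_quot_spec[]. Qed.

Lemma mu_quot_bound N : submod N -> (mu_quot p N <= size e)%N.
Proof.
move=> sN; apply: mu_quot_le => // y; apply: sub_clos; exists 0.
by split; [exact: submod0|rewrite subr0].
Qed.

Lemma mu_quot_addv N x : submod N -> (mu_quot p N <= (mu_quot p (addv N x)).+1)%N.
Proof.
move=> sN; have [g [<- gP]] := mu_quot_gen (submod_addv x sN).
by apply: (mu_quot_le (g := x :: g)) => //; rewrite adds_cons.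
Qed.

Lemma mu_quot_addv_clos N x : submod N -> clos N x ->
  (mu_quot p N <= mu_quot p (addv N x))%N.
Proof.
move=> sN Nx; have [g [<- gP]] := mu_quot_gen (submod_addv x sN).
have sg := submod_adds g sN; have sc := submod_clos sg.
apply: mu_quot_le => // y; apply: clos_sub (gP y) => //.
apply: adds_sub => //; last by move=> z zg; apply/sub_clos/adds_mem.
apply: addv_sub => //; first by move=> z Nz; apply/sub_clos/sub_adds.
by apply: closS Nx => // z; apply: sub_adds.
Qed.

(** Running through [g], the first element whose adjunction brings [x] into the span is the one that
    [x] replaces. *)
Lemma steinitz N g x : submod N -> ~ clos N x -> clos (adds N g) x ->
  exists g', size g = (size g').+1 /\ forall y, adds N g y -> clos (adds N (x :: g')) y.
Proof.
elim: g N => [|y g IHg] N sN NNx; first by rewrite adds_nil.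
rewrite adds_cons // => gx; have sy := submod_addv y sN.
have [yx|Nyx] := pselect (clos (addv N y) x).
  exists g; split=> // z; rewrite adds_cons //.
  have sx := submod_addv x sN; have sxg := submod_adds g sx; have sc := submod_clos sxg.
  apply: adds_sub => //; last by move=> w wg; apply/sub_clos/adds_mem.
  apply: addv_sub => //; first by move=> w Nw; apply/sub_clos/sub_adds/sub_addv.
  by apply: closS (clos_addv_exchange sN yx NNx) => // w; apply: sub_adds.
have [g' [szg g'P]] := IHg _ sy Nyx gx; exists (y :: g'); split; first by rewrite /= szg.
rewrite (adds_perm (g := [:: x, y & g']) (g' := [:: y, x & g'])) // => [z /g'P|z].
  by rewrite -adds_cons.
by rewrite !in_cons orbCA.
Qed.

Lemma mu_quot_addvN N x : submod N -> ~ clos N x ->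
  (mu_quot p (addv N x) < mu_quot p N)%N.
Proof.
move=> sN NNx; have [g [<- gP]] := mu_quot_gen sN.
have [g' [-> g'P]] := steinitz sN NNx (gP x).
apply: mu_quot_le; first exact: submod_addv.
move=> y; apply: clos_sub (gP y); rewrite -?adds_cons //.
by rewrite adds_cons //; apply/submod_adds/submod_addv.
Qed.

(** Adjoin the elements of [s] one by one: each lowers [mu_quot] unless it already lies in the span
    of [N] and the preceding ones, which is a relation with a coefficient outside [p]. *)
Lemma rank_or_relation N s : submod N ->
  (mu_quot p (adds N s) + size s <= mu_quot p N)%N \/
  exists C : nat -> R, (exists2 i, (i < size s)%N & ~ p (C i)) /\
    clos N (\sum_(i < size s) C i *: s`_i).
Proof.
elim: s N => [|x s IHs] N sN; first by left; rewrite adds_nil ?addn0.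
have [xP|NxP] := pselect (clos N x).
  right; exists (fun i => (i == 0)%:R); split; first by exists 0%N => //; apply: primeN1.
  by rewrite big_ord_recl /= scale1r big1 ?addr0 // => i _; rewrite scale0r.
have := mu_quot_addvN sN NxP; have sx := submod_addv x sN; rewrite adds_cons //.
have [|[C [[i lti NpC] [u [Npu [z [[r Nr] pz]]]]]]] := IHs _ sx; first by left; rewrite /=; lia.
(* The relation for the tail holds modulo [N + R x]: [u] times it equals [r *: x] modulo [N] and
   [p M], whence the coefficient [- r] of [x]. *)
move=> _; right; exists (fun i => if i is j.+1 then u * C j else - r); split.
  by exists i.+1 => //; apply: primeNM.
rewrite big_ord_recl /=; apply: sub_mloc; exists (z - r *: x); split=> //.
under eq_bigr do rewrite -scalerA.
by rewrite -scaler_sumr scaleNr opprB [- _ + _]addrC addrA subrK.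
Qed.

End Generators.
End AtPrime.

(** Semicontinuity: [S] is the union of the annihilators of [M / (N + R g)] over all [g] with fewer
    than [h] elements, and fewer than [h] generators suffice at [q] exactly when [q] misses an
    element of [S]. *)
Lemma mu_quot_closed e N h : (forall x, mspan e x) -> submod N ->
  exists S : R -> Prop, forall q, prime_ideal q ->
    (h <= mu_quot q N)%N <-> (forall r, S r -> q r).
Proof.
move=> eP sN; exists (fun r => exists2 g, (size g < h)%N & forall y, adds N g (r *: y)).
move=> q prq; split=> [leh r [g ltg gP]|Sq].
  apply: contrapT => Nqr; move: ltg; rewrite ltnNge => /negP; apply.
  apply: leq_trans leh _; apply: (mu_quot_le prq eP sN) => y.
  by apply/mloc_clos; exists r.
rewrite leqNgt; apply/negP => ltmu.
have [g [szg gP]] := mu_quot_gen prq eP sN.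
have sg := submod_adds g sN; have {}gP := nakayama prq eP sg gP.
have [t Nqt tP] : exists2 t, ~ q t & forall x, x \in e -> adds N g (t *: x).
  elim: (e) => [|x s [t Nqt tP]]; first by exists 1 => //; apply: primeN1.
  have [u [Nqu uP]] := gP x; exists (t * u); first exact: primeNM.
  move=> y; rewrite in_cons => /orP[/eqP->|/tP]; first by rewrite -scalerA; apply: submodZ.
  by rewrite mulrC -scalerA; apply: submodZ.
apply: Nqt; apply: Sq; exists g; first by rewrite szg.
move=> y; apply: (mspan_sub (N := fun y => adds N g (t *: y)) _ tP (eP y)).
split=> [|z w gz gw|r z gz]; first by rewrite scaler0; apply: submod0.
  by rewrite scalerDr; apply: submodD.
by rewrite scalerA mulrC -scalerA; apply: submodZ.
Qed.

End Submodules.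

Lemma finite_union (T : eqType) (P : nat -> T -> Prop) n :
  (forall i, (i < n)%N -> exists s : seq T, forall x, P i x -> x \in s) ->
  exists s : seq T, forall x i, (i < n)%N -> P i x -> x \in s.
Proof.
elim: n => [|n IHn] H; first by exists [::].
have [s sP] := IHn (fun i lti => H i (ltnW lti)); have [t tP] := H n (ltnSn n).
exists (s ++ t) => x i; rewrite ltnS leq_eqVlt mem_cat => /orP[/eqP->/tP->|lti /(sP _ _ lti)->//].
by rewrite orbT.
Qed.

(** * Basic elements *)

Section BasicElements.
Variables (R : comNzRingType) (M : lmodType R) (n : nat).
Hypothesis HR : noetherian R.
Variable e : seq M.
Hypothesis eP : forall x : M, mspan e x.
Hypothesis Hmono : forall p q : R -> Prop, Cn n p -> Cn n q ->
  (depth q < depth p)%N -> (mu M q <= mu M p)%N.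

Lemma sbasicE (N : M -> Prop) k p : sbasic (M := M) N k%:Z p <-> (mu_quot p N + k <= mu M p)%N.
Proof. by rewrite /sbasic; split; lia. Qed.

Lemma finite_critical (N : M -> Prop) m : submod N ->
  (forall p, Cn n p -> (mu_quot p N + minn m.+1 (n.+1 - depth p) <= mu M p)%N) ->
  exists s : seq (R -> Prop), forall p, Cn n p -> (n.+1 - depth p <= m)%N ->
    (mu_quot p N + (n.+1 - depth p) = mu M p)%N -> p \in s.
Proof.
move=> sN HN.
have [s sP] : exists s : seq (R -> Prop), forall p u, (u < n.+1)%N ->
    [/\ Cn n p, (n.+1 - u <= m)%N, (mu_quot p N + (n.+1 - u) = mu M p)%N & depth p = u] ->
    p \in s.
  apply: finite_union => u ltu.
  (* Besides [u <= n], the number [h] is bounded by the number of generators of [M], so finitely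
     many pairs [(u, h)] occur. *)
  have [s sP] : exists s : seq (R -> Prop), forall p h, (h < (size e).+1)%N ->
    [/\ Cn n p, (n.+1 - u <= m)%N, (h + (n.+1 - u) = mu M p)%N, depth p = u & mu_quot p N = h] ->
    p \in s.
    apply: finite_union => h _.
    have [S SP] := mu_quot_closed h eP sN.
    have [[p [Cp ltm muE dp hE]]|Nex] := pselect (exists p : R -> Prop,
      [/\ Cn n p, (n.+1 - u <= m)%N, (h + (n.+1 - u) = mu M p)%N, depth p = u & mu_quot p N = h]).
      have [|s sP] := finite_depth_locus HR (S := S) (u := u).
        (* If [depth q < u], the hypothesis at [q] gives [mu_quot q N + (n + 2 - u) <= mu M q],
           while monotonicity gives [mu M q <= mu M p = h + (n + 1 - u)]; so [mu_quot q N < h]. *)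
        move=> q prq /(SP _ prq) leh; rewrite leqNgt; apply/negP => ltd.
        have Cq : Cn n q by split=> //; lia.
        by have := HN _ Cq; have := Hmono Cp Cq; rewrite dp ltd => /(_ isT); lia.
      exists s => q [[prq _] _ _ dq hq]; apply: sP => //.
      by apply/(SP _ prq); rewrite hq.
    by exists [::] => p pP; case: Nex; exists p.
  exists s => p [Cp ltm muE dp]; apply: (sP p (mu_quot p N)) => //.
  by rewrite ltnS; apply: (mu_quot_bound Cp.1 eP).
exists s => p Cp ltm muE; apply: (sP p (depth p)) => //.
by rewrite ltnS; case: Cp.
Qed.

Definition shift (s : seq M) (y : M) (a : nat -> R) : seq M :=
  mkseq (fun i => s`_i + a i *: y) (size s).

(** Only [y] is lost in passing to the shifted list, so [mu_quot] rises by at most one. *)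
Lemma addv_shift s y a : addv (mspan (shift s y a)) y = mspan (y :: s).
Proof.
have sS := submod_addv y (submod_mspan (shift s y a)).
have sy := submod_mspan (y :: s); apply/predeqP => z; split.
  have ys : mspan (y :: s) y by apply: mspan_mem; rewrite mem_head.
  apply: addv_sub => //; apply: mspan_sub => // w /mapP[i]; rewrite mem_iota /= => lti ->.
  apply: submodD => //; last exact: submodZ.
  by apply: mspan_mem; rewrite in_cons mem_nth ?orbT.
have yS := addv_mem y (submod_mspan (shift s y a)).
apply: mspan_sub => // w; rewrite in_cons => /orP[/eqP->//|ws].
have lti : (index w s < size s)%N by rewrite index_mem.
apply: (submod_sub sS (y := - (a (index w s) *: y))); last first.
  by apply: submodN => //; apply: submodZ.
apply/sub_addv/mspan_mem; rewrite opprK; apply/mapP; exists (index w s).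
  by rewrite mem_iota.
by rewrite nth_index.
Qed.

(* A relation [C] among [y, s_0, s_1, ...] in [M (x) k(p)] expresses [y] through
   [shift s y a] as soon as [relval C a] is nonzero in [k(p)]. *)
Definition relval (s : seq M) (C a : nat -> R) : R :=
  \sum_(i < size s) C i.+1 * a i - C 0%N.

Lemma relval_clos p s y (C a : nat -> R) : prime_ideal p ->
  clos p (@zero_sub R M) (\sum_(i < size (y :: s)) C i *: (y :: s)`_i) ->
  ~ p (relval s C a) -> clos p (mspan (shift s y a)) y.
Proof.
move=> prp relC Npf; have sS := submod_mspan (shift s y a).
have sc := submod_clos prp sS; apply: (closZ prp Npf).
have := relC; rewrite big_ord_recl /= => {}relC.
have -> : relval s C a *: y = \sum_(i < size s) C i.+1 *: (s`_i + a i *: y) -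
    (C 0%N *: y + \sum_(i < size s) C i.+1 *: s`_i).
  under [in RHS]eq_bigr do rewrite scalerDr scalerA.
  rewrite big_split /= -scaler_suml [C 0%N *: y + _]addrC.
  by rewrite [X in _ = X - _]addrC addrKA -scalerBl.
apply: submodB => //; last first.
  by apply: (closS prp sS _ relC); apply: zero_sub_sub.
apply: (submod_sum sc) => i; apply: (submodZ sc); apply/(sub_clos prp)/mspan_mem.
by apply/mapP; exists (i : nat); rewrite // mem_iota ltn_ord.
Qed.

Lemma basic_reduction s y :
  (forall p, Cn n p ->
     sbasic (mspan (y :: s)) (minn (size s).+1 (n.+1 - depth p))%:Z p) ->
  exists a, forall p, Cn n p ->
     sbasic (mspan (shift s y a)) (minn (size s) (n.+1 - depth p))%:Z p.
Proof.
move=> Hys; have {}Hys p Cp := (sbasicE _ _ _).1 (Hys p Cp).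
pose critical (p : R -> Prop) := [/\ Cn n p, (n.+1 - depth p <= size s)%N &
  (mu_quot p (mspan (y :: s)) + (n.+1 - depth p) = mu M p)%N].
have [t tP] := finite_critical (submod_mspan (y :: s)) Hys.
pose good (p : R -> Prop) a := exists C, clos p (@zero_sub R M)
  (\sum_(i < size (y :: s)) C (i : nat) *: (y :: s)`_i) /\ ~ p (relval s C a).
have relmix C r a b : relval s C (fun i => a i + r * (b i - a i)) =
    relval s C a + r * (relval s C b - relval s C a).
  rewrite /relval; have -> : \sum_(i < size s) C i.+1 * (a i + r * (b i - a i)) =
    \sum_(i < size s) C i.+1 * a i +
    r * (\sum_(i < size s) C i.+1 * b i - \sum_(i < size s) C i.+1 * a i).
    by rewrite -sumrB mulr_sumr -big_split /=; apply: eq_bigr => i _; ring.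
  by ring.
have relval0 C : relval s C (fun=> 0) = - C 0%N.
  by rewrite /relval big1 ?sub0r // => i _; rewrite mulr0.
have crit p : p \in [seq p <- t | `[<critical p>]] -> critical p.
  by rewrite mem_filter => /andP[/asboolP].
have [p /crit[[]]//|p /crit cp|p /crit cp r a b pr [C [relC Npa]]|
      p /crit cp r a b Npr Nga [C [relC Npb]]|a aP] :=
  general_position (fun=> 0) (mix := fun r a b i => a i + r * (b i - a i))
    (good := good) (s := [seq p <- t | `[<critical p>]]).
- have [[prp _] les muE] := cp; have idp := prime_is_ideal prp.
  (* Independence of [y :: s] would force [mu M p] to exceed [mu_quot] by at least [size s + 1], but
     at a critical prime the difference is at most [size s]. *)
  have [|[C [[[|i] lti NpC] relC]]] := rank_or_relation prp eP (y :: s) (submod_zero M).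
  + rewrite adds_zero /=; move: muE; rewrite /mu; rewrite /zero_sub; lia.
  + exists (fun=> 0); exists C; split=> //; rewrite relval0 => pC.
    by apply: NpC; rewrite -[C 0%N]opprK; apply: idealN pC.
  + have [pC0|NpC0] := pselect (p (C 0%N)); last first.
      exists (fun=> 0); exists C; split=> //; rewrite relval0 => pC.
      by apply: NpC0; rewrite -[C 0%N]opprK; apply: idealN pC.
    (* With [C 0] in [p] and [C i.+1] outside, this unit vector gives [relval] the value
       [C i.+1 - C 0], which is outside [p]. *)
    exists (fun j => (j == i)%:R); exists C; split=> //; rewrite /relval.
    rewrite (bigD1 (Ordinal (lti : (i < size s)%N))) //= eqxx mulr1 big1 ?addr0 => [pC|j].
      by apply: NpC; apply: (ideal_sub idp pC).
    by rewrite -val_eqE /= => /negbTE->; rewrite mulr0.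
- have [[prp _] _ _] := cp; have idp := prime_is_ideal prp.
  exists C; split=> //; rewrite relmix => pm; apply: Npa.
  rewrite -[relval s C a](addrK (r * (relval s C b - relval s C a))).
  by apply: idealB => //; apply: idealMr.
- have [[prp _] _ _] := cp; have idp := prime_is_ideal prp.
  (* The relation [C] that serves [b] is kept; as [a] is not good, the value of [C] at [a] lies in
     [p]. *)
  have pa : p (relval s C a) by apply: contrapT => Npa; apply: Nga; exists C.
  exists C; split=> //; rewrite relmix => pm; apply: (primeNM prp Npr Npb).
  have -> : r * relval s C b = relval s C a + r * (relval s C b - relval s C a) -
    (1 - r) * relval s C a by ring.
  by apply: idealB => //; apply: idealMl.
exists a => p Cp; apply/sbasicE; have prp := Cp.1.
have sS := submod_mspan (shift s y a).
have := Hys p Cp; rewrite -(addv_shift s y a).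
have [cp|Ncp] := pselect (critical p).
  have [C [relC NpC]] : good p a.
    apply: aP; rewrite mem_filter; apply/andP; split; first exact/asboolP.
    by case: cp => *; apply: tP.
  have := mu_quot_addv_clos prp eP sS (relval_clos prp relC NpC).
  by lia.
(* Away from the critical primes a rise by one is harmless: either the required minimum also drops
   by one, or the hypothesis holds with strict inequality. *)
have := mu_quot_addv prp eP y sS => le1.
have : ~ ((n.+1 - depth p <= size s)%N /\
    (mu_quot p (addv (mspan (shift s y a)) y) + (n.+1 - depth p) = mu M p)%N).
  by rewrite addv_shift => -[*]; apply: Ncp.
by lia.
Qed.

Lemma basic_element x1 xs :
  (forall p, Cn n p ->
     sbasic (mspan (x1 :: xs)) (minn (size xs).+1 (n.+1 - depth p))%:Z p) ->
  exists x' : M, mspan xs x' /\ forall p, Cn n p -> basic (x1 + x') p.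
Proof.
move sz: (size xs) => k; elim: k => [|k IHk] in x1 xs sz *.
  move/size0nil: sz => -> Hx; exists 0; split; first exact: submod0 (submod_mspan _).
  move=> p Cp; rewrite addr0 /basic; have := Hx p Cp.
  (* Here [depth p <= n] makes the second argument positive. *)
  have -> : minn 1 (n.+1 - depth p) = 1%N by case: Cp => _; lia.
  suff -> : mspan [:: x1] = (fun z => exists r : R, z = r *: x1) by [].
  apply/predeqP => z; split=> [[c]|[r ->]]; first by rewrite big_ord1; exists c`_0.
  by apply: submodZ; [exact: submod_mspan|apply: mspan_mem; rewrite mem_head].
case: xs sz => [|y ys] //= [sz] Hx.
(* It is [y] that gets eliminated, so the head of the new list is [x1] plus a multiple of [y], and
   [x1] keeps the coefficient 1. *)
have swap : mspan [:: x1, y & ys] = mspan [:: y, x1 & ys].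
  by rewrite -!adds_zero; apply: adds_perm => [|z]; [exact: submod_zero|rewrite !in_cons orbCA].
have [p Cp|a aP] := @basic_reduction (x1 :: ys) y.
  by rewrite -swap /= sz; apply: Hx.
pose ys' := mkseq (fun i => ys`_i + a i.+1 *: y) (size ys).
have shiftE : shift (x1 :: ys) y a = (x1 + a 0%N *: y) :: ys'.
  by rewrite /shift /mkseq /= (iotaDl 1 0) -map_comp.
have [||x' [x'P bP]] := IHk (x1 + a 0%N *: y) ys'.
- by rewrite size_mkseq.
- by move=> p /aP; rewrite shiftE /= sz.
have sy := submod_mspan (y :: ys).
have yy : mspan (y :: ys) y by apply: mspan_mem; rewrite mem_head.
exists (a 0%N *: y + x'); split; last by move=> p /bP; rewrite addrA.
apply: submodD => //; first exact: submodZ.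
apply: mspan_sub x'P => // w /mapP[i]; rewrite mem_iota /= => lti ->.
apply: submodD => //; last exact: submodZ.
by apply: mspan_mem; rewrite in_cons mem_nth ?orbT.
Qed.

End BasicElements.

Theorem theorem1 (R : comNzRingType) (M : lmodType R) (n : nat)
  (HR : noetherian R) (HM : fin_gen M)
  (Hmono : forall p q : R -> Prop, Cn n p -> Cn n q ->
     (depth q < depth p)%N -> (mu M q <= mu M p)%N) :
  ((forall p : R -> Prop, Cn n p -> (n < mu M p)%N) ->
     exists x : M, forall p : R -> Prop, Cn n p -> basic x p) /\
  (forall (x1 : M) (xs : seq M),
     (forall p : R -> Prop, Cn n p ->
        sbasic (mspan (x1 :: xs)) (minn (size xs).+1 (n.+1 - depth p))%:Z p) ->
     exists x' : M, mspan xs x' /\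
       forall p : R -> Prop, Cn n p -> basic (x1 + x') p).
Proof.
case: HM => e eP; split=> [ltn_mu|x1 xs]; last exact: (basic_element HR eP Hmono).
(* For part (1), [x1 = 0] followed by the generators [e] spans [M], so the quotient needs no
   generators, and the required minimum is at most [n + 1]. *)
have [p Cp|x' [_ x'P]] := basic_element HR eP Hmono (x1 := 0) (xs := e); last first.
  by exists (0 + x').
apply/sbasicE; have s0 := submod_mspan (0 :: e).
have : (mu_quot p (mspan (0%R :: e)) <= size (@nil M))%N.
  apply: (mu_quot_le Cp.1 eP s0) => y; apply: (sub_clos Cp.1).
  rewrite adds_nil //; apply: mspan_sub (eP y) => // x xe.
  by apply: mspan_mem; rewrite in_cons xe orbT.
by have := ltn_mu p Cp; rewrite /=; lia.
Qed.
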